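(* Let $H$ and $K$ be non-zero complex Hilbert spaces, let $A\in\mathbb{B}(K,H)\setminus\{0\}$ and $a,b,c\in\mathbb{C}$, and let $$T=\begin{pmatrix} aI_H & A\\ cA^* & bI_K\end{pmatrix}\in\mathbb{B}(H\oplus K).$$ Put $d=\|A\|$. For $t>0$ let $S_t=\begin{pmatrix} a & t\\ ct & b\end{pmatrix}\in M_2(\mathbb{C})$, and let $E_d=\bigcup_{t\in(0,d)}W(S_t)$. Then $$W(T)=W(S_d)\quad\text{or}\quad W(T)=E_d.$$ Moreover, the following statements are equivalent: (i) $W(T)=W(S_d)$; (ii) $A$ attains its norm; (iii) $T$ attains its norm.
   Context: $\mathbb{B}(K,H)$ denotes the set of bounded linear operators from $K$ to $H$, and $\mathbb{B}(H)=\mathbb{B}(H,H)$. $H\oplus K$ is the Hilbert space direct sum, with inner product $\langle (x_1,y_1)^T,(x_2,y_2)^T\rangle=\langle x_1,x_2\rangle+\langle y_1,y_2\rangle$. The numerical range of a bounded operator $B$ on a Hilbert space $L$ is $W(B)=\{\langle Bx,x\rangle: x\in L,\ \|x\|=1\}$; for a matrix in $M_2(\mathbb{C})$ it is taken with respect to the standard inner product on $\mathbb{C}^2$. A bounded linear operator $B$ between Hilbert spaces attains its norm if there is a unit vector $x$ in its domain with $\|Bx\|=\|B\|$. *)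

(* Defs.v *)
From HB Require Import structures.
From mathcomp Require Import all_boot all_order all_algebra.
From mathcomp Require Import complex.
From mathcomp Require Import boolp classical_sets reals topology normedtype.
From mathcomp Require Import ring lra.

Set Implicit Arguments.
Unset Strict Implicit.
Unset Printing Implicit Defensive.

Import Order.TTheory GRing.Theory Num.Theory Num.Def.
Import numFieldNormedType.Exports.

Local Open Scope classical_set_scope.
Local Open Scope ring_scope.
Local Open Scope complex_scope.

Section DotForm.
Variables (C : numClosedFieldType) (U : lmodType C) (form : {dot U for conjC}).

Lemma dot_CauchySchwarz u v : `|form u v| ^+ 2 <= form u u * form v v.
Proof.
have [->|v0] := eqVneq v 0; first by rewrite !linear0r normr0 expr0n /= mulr0.
have vv : 0 < form v v by rewrite dnorm_gt0.
have H := dnorm_ge0 form (form v v *: u - form u v *: v).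
have E : form (form v v *: u - form u v *: v) (form v v *: u - form u v *: v)
   = form v v * (form u u * form v v - `|form u v| ^+ 2).
  rewrite dnormB !dnormZ linearZl_LR linearZr_LR/= !rmorphM/=.
  rewrite !normCK !(geC0_conj (ltW vv)) ?conjCK.
  ring.
by move: H; rewrite E pmulr_rge0// subr_ge0.
Qed.

Lemma dot_triangle u v :
  sqrtC (form (u + v) (u + v)) <= sqrtC (form u u) + sqrtC (form v v).
Proof.
rewrite -ler_sqr ?nnegrE ?addr_ge0 ?sqrtC_ge0 ?dnorm_ge0//.
rewrite sqrrD !sqrtCK dnormD [leLHS]addrAC lerD2r lerD2l.
have -> : form u v + conjC (form u v) = 'Re (form u v) *+ 2.
  by rewrite ReE -mulr_natr divfK ?pnatr_eq0.
rewrite lerMn2r/=; apply: (le_trans (leif_Re_Creal _)).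
rewrite -ler_sqr ?nnegrE ?mulr_ge0 ?sqrtC_ge0 ?dnorm_ge0//.
by rewrite exprMn !sqrtCK dot_CauchySchwarz.
Qed.
End DotForm.

(* Inner products are linear in the first argument and conjugate-linear in the
   second; norms over R[i] take their (real, nonnegative) values in R[i]. *)
HB.mixin Record CompleteNormedModule_isHilbert (R : realType) H
    & CompleteNormedModule R[i] H := {
  inner : {dot H for (@conjC R[i])};
  inner_norm : forall x : H, inner x x = `|x| ^+ 2
}.

#[short(type="hilbertType")]
HB.structure Definition Hilbert (R : realType) :=
  {H of CompleteNormedModule R[i] H & CompleteNormedModule_isHilbert R H}.

Section DirectSum.
Variables (R : realType) (H K : hilbertType R).

(* An alias of H * K, because the library norms H * K with the maximum of the
   two norms. *)
Definition hsum : Type := (H * K)%type.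
HB.instance Definition _ := GRing.Lmodule.copy hsum (H * K)%type.

Definition hsum_inner (u v : hsum) : R[i] := inner u.1 v.1 + inner u.2 v.2.

Lemma hsum_inner_linear_l v : linear_for *%R (hsum_inner ^~ v).
Proof. by move=> a x y; rewrite /hsum_inner/= !linearPl/=; ring. Qed.

Lemma hsum_inner_linear_r u : linear_for (conjC \; *%R) (hsum_inner u).
Proof. by move=> a x y; rewrite /hsum_inner/= !linearPr/=; ring. Qed.

HB.instance Definition _ :=
  bilinear_isBilinear.Build R[i] hsum hsum R[i] *%R (conjC \; *%R) hsum_inner
    (conj hsum_inner_linear_l hsum_inner_linear_r).

Lemma hsum_inner_hermitian (u v : hsum) :
  hsum_inner u v = (-1) ^+ false * conjC (hsum_inner v u).
Proof.
by rewrite /hsum_inner rmorphD mul1r (hermC _ u.1) (hermC _ u.2) !mul1r.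
Qed.

HB.instance Definition _ :=
  isHermitianSesquilinear.Build R[i] hsum false conjC hsum_inner
    hsum_inner_hermitian.

Lemma hsum_inner_gt0 (u : hsum) : u != 0 -> 0 < hsum_inner u u.
Proof.
move=> u0; rewrite lt_def addr_ge0 ?dnorm_ge0// andbT.
apply: contra u0; rewrite paddr_eq0 ?dnorm_ge0// !dnorm_eq0.
by case: u => x y /= /andP[/eqP-> /eqP->].
Qed.

HB.instance Definition _ :=
  isDotProduct.Build R[i] hsum hsum_inner hsum_inner_gt0.

Definition hsum_norm (u : hsum) : R[i] := sqrtC (hsum_inner u u).

Lemma hsum_norm_triangle (u v : hsum) :
  hsum_norm (u + v) <= hsum_norm u + hsum_norm v.
Proof. exact: dot_triangle. Qed.

Lemma hsum_normZ (l : R[i]) (u : hsum) : hsum_norm (l *: u) = `|l| * hsum_norm u.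
Proof.
by rewrite /hsum_norm dnormZ rootCMl ?exprn_ge0// sqrCK.
Qed.

Lemma hsum_norm_eq0 (u : hsum) : hsum_norm u = 0 -> u = 0.
Proof. by move=> /eqP; rewrite sqrtC_eq0 dnorm_eq0 => /eqP. Qed.

HB.instance Definition _ := Lmodule_isNormed.Build R[i] hsum
  hsum_norm_triangle hsum_normZ hsum_norm_eq0.

Lemma hsum_normE (u : hsum) : `|u| ^+ 2 = `|u.1| ^+ 2 + `|u.2| ^+ 2.
Proof. by rewrite [LHS]sqrtCK /hsum_inner !inner_norm. Qed.

Lemma hsum_norm_fst (u : hsum) : `|u.1| <= `|u|.
Proof. by rewrite -ler_sqr ?nnegrE// hsum_normE lerDl exprn_ge0. Qed.

Lemma hsum_norm_snd (u : hsum) : `|u.2| <= `|u|.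
Proof. by rewrite -ler_sqr ?nnegrE// hsum_normE lerDr exprn_ge0. Qed.

Lemma hsum_norm_le (u : hsum) : `|u| <= `|u.1| + `|u.2|.
Proof.
rewrite -ler_sqr ?nnegrE ?addr_ge0// hsum_normE sqrrD -addrA lerD2l lerDr.
by rewrite mulrn_wge0// mulr_ge0.
Qed.

Lemma hsum_complete (F : set_system hsum) : ProperFilter F -> cauchy F -> cvg F.
Proof.
move=> FF /cauchyP Fc.
have F1 : cvg (fst @ F).
  apply: cauchy_cvg; apply: cauchy_exP => e e0; have [u Fu] := Fc e e0.
  exists u.1; apply: (@filterS _ F _ (ball u e) (fst @^-1` ball u.1 e)) Fu => v.
  rewrite /= -!ball_normE /ball_/=; apply: le_lt_trans.
  exact: (hsum_norm_fst (u - v)).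
have F2 : cvg (snd @ F).
  apply: cauchy_cvg; apply: cauchy_exP => e e0; have [u Fu] := Fc e e0.
  exists u.2; apply: (@filterS _ F _ (ball u e) (snd @^-1` ball u.2 e)) Fu => v.
  rewrite /= -!ball_normE /ball_/=; apply: le_lt_trans.
  exact: (hsum_norm_snd (u - v)).
apply/cvg_ex; exists ((lim (fst @ F), lim (snd @ F)) : hsum).
apply/cvgrPdist_lt => e e0.
have e20 : 0 < e / 2 by rewrite divr_gt0.
have N1 : \forall v \near F, `|lim (fst @ F) - v.1| < e / 2.
  by have /cvgrPdist_lt/(_ _ e20) := F1.
have N2 : \forall v \near F, `|lim (snd @ F) - v.2| < e / 2.
  by have /cvgrPdist_lt/(_ _ e20) := F2.
near=> v; apply: (le_lt_trans (hsum_norm_le _)); rewrite [e]splitr.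
by apply: ltrD; [near: v; exact: N1|near: v; exact: N2].
Unshelve. all: by end_near. Qed.

HB.instance Definition _ := Uniform_isComplete.Build hsum hsum_complete.

Lemma hsum_inner_norm (u : hsum) : hsum_inner u u = `|u| ^+ 2.
Proof. by rewrite sqrtCK. Qed.

HB.instance Definition _ :=
  CompleteNormedModule_isHilbert.Build R hsum hsum_inner_norm.

End DirectSum.

HB.mixin Record isBounded (K : numFieldType) (V W : normedModType K)
    (f : V -> W) := {
  bounded_subproof : bounded_near f (nbhs (0 : V))
}.

#[short(type="boundedOp")]
HB.structure Definition BoundedOp (K : numFieldType) (V W : normedModType K) :=
  {f of @GRing.Linear K V W *:%R f & isBounded K V W f}.

Lemma bounded_nearP (K : numFieldType) (V W : normedModType K)
    (f : {linear V -> W}) :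
  bounded_near f (nbhs (0 : V)) <->
  exists2 M : K, 0 <= M & forall x, `|f x| <= M * `|x|.
Proof.
split=> [/linear_boundedP/pinfty_ex_gt0[M M0 fM]|[M M0 fM]].
  by exists M => //; exact: ltW.
apply/bounded_funP => r; exists (M * r) => x xr.
exact: (le_trans (fM x)) (ler_wpM2l M0 xr).
Qed.

Section OperatorNorm.
Variables (R : realType) (V W : normedModType R[i]).

Definition opnorm (f : boundedOp V W) : R :=
  sup [set complex.Re `|f x| | x in [set x | `|x| <= 1]].

Definition attains_norm (f : boundedOp V W) : Prop :=
  exists x, `|x| = 1 /\ `|f x| = (opnorm f)%:C.

End OperatorNorm.

Definition numrange (R : realType) (H : hilbertType R) (B : boundedOp H H)
  : set R[i] := [set inner (B x) x | x in [set x | `|x| = 1]].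

Section Riesz.
Variables (R : realType) (H : hilbertType R).
Local Notation re := (@complex.Re R).

Let nsq (x : H) : R := re (inner x x).

Let nsqE x : inner x x = (nsq x)%:C.
Proof. by rewrite RRe_real// ger0_real// dnorm_ge0. Qed.

Let nsq_ge0 x : 0 <= nsq x.
Proof. by rewrite -lecR -nsqE dnorm_ge0. Qed.

Let nsq_eq0 x : nsq x = 0 -> x = 0.
Proof. by move=> x0; apply/eqP; rewrite -(dnorm_eq0 (@inner R H)) nsqE x0. Qed.

Let normE x : `|x| = (Num.sqrt (nsq x))%:C.
Proof.
apply/eqP; rewrite -(@eqrXn2 _ 2)// ?lecR ?sqrtr_ge0//.
by rewrite -inner_norm nsqE -rmorphXn/= sqr_sqrtr.
Qed.

Let re_conj (x : R[i]) : re (conjC x) = re x.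
Proof. by case: x. Qed.

Let reC (x y : H) : re (inner x y) = re (inner y x).
Proof. by rewrite (hermC (@inner R H)) mul1r re_conj. Qed.

Let reD (x y : R[i]) : re (x + y) = re x + re y.
Proof. by case: x; case: y. Qed.

Let reN (x : R[i]) : re (- x) = - re x.
Proof. by case: x. Qed.

Let reZ (t : R) (x : R[i]) : re (t%:C * x) = t * re x.
Proof. by case: x => a b /=; rewrite mul0r subr0. Qed.

Let re_CS (x y : H) : re (inner x y) ^+ 2 <= nsq x * nsq y.
Proof.
have := dot_CauchySchwarz (@inner R H) x y; rewrite !nsqE -rmorphM/=.
by case: (inner x y) => a b; rewrite sqr_normc; simpc => /andP[_];
   rewrite -!expr2 => /(le_trans _); apply; rewrite lerDl sqr_ge0.
Qed.

Variables (phi : H -> R[i]) (M : R[i]).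
Hypotheses (phi_lin : linear_for *%R phi).
Hypothesis (M0 : 0 <= M) (phiM : forall x, `|phi x| <= M * `|x|).

Let phiD x y : phi (x + y) = phi x + phi y.
Proof. by have := phi_lin 1 x y; rewrite scale1r mul1r. Qed.

Let phi0 : phi 0 = 0.
Proof. by apply: (addrI (phi 0)); rewrite -phiD !addr0. Qed.

Let phiZ k x : phi (k *: x) = k * phi x.
Proof. by rewrite -[k *: x]addr0 phi_lin phi0 addr0. Qed.

Let J x := nsq x - 2 * re (phi x).

Let nsqD x y : nsq (x + y) = nsq x + nsq y + 2 * re (inner x y).
Proof.
by rewrite /nsq dnormD !reD re_conj mulr2n mulrDl !mul1r.
Qed.

Let conjR (t : R) : conjC t%:C = t%:C.
Proof. exact: conjc_real. Qed.

Let nsqZ (t : R) x : nsq (t%:C *: x) = t ^+ 2 * nsq x.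
Proof.
by rewrite /nsq linearZl_LR linearZr_LR/= conjR !reZ mulrA.
Qed.

Let J_line x y (t : R) : J (x + t%:C *: y) =
  J x + 2 * t * (re (inner x y) - re (phi y)) + t ^+ 2 * nsq y.
Proof.
rewrite /J nsqD nsqZ phiD phiZ reD !reZ linearZr_LR/= conjR reZ; ring.
Qed.

Let mid x y :
  nsq (x - y) = 2 * (J x + J y - 2 * J (2^-1%:C *: (x + y))).
Proof.
rewrite /J nsqZ phiZ reZ phiD reD.
have -> : nsq (x - y) = nsq x + nsq y - 2 * re (inner x y).
  by rewrite /nsq dnormB !reD reN reD re_conj; ring.
by rewrite nsqD; field.
Qed.

Let re_phi x : re (phi x) <= re M * Num.sqrt (nsq x).
Proof.
have := phiM x; rewrite normE -(RRe_real (ger0_real M0)) -rmorphM/= => h.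
rewrite -lecR; apply: le_trans h.
by rewrite complexRe; exact: (leif_Re_Creal (phi x)).1.
Qed.

Let m := inf (range J).

Let has_infJ : has_inf (range J).
Proof.
split; first by exists (J 0), 0.
exists (- (re M) ^+ 2) => _ [x _ <-].
rewrite -subr_ge0 /J; set s := Num.sqrt (nsq x).
have -> : nsq x = s ^+ 2 by rewrite sqr_sqrtr.
have H1 : 0 <= (s - re M) ^+ 2 by rewrite sqr_ge0.
have H2 := re_phi x; rewrite -/s in H2.
apply: (le_trans H1); rewrite sqrrB -subr_ge0.
rewrite [leRHS](_ : _ = (re M * s - re (phi x)) *+ 2); last by ring.
by rewrite mulrn_wge0// subr_ge0.
Qed.

Let m_le x : m <= J x.
Proof. by apply: ge_inf; [case: has_infJ|exists x]. Qed.

Let near_min (x y : H) (d : R) : J x < m + d ->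
  (re (inner x y) - re (phi y)) ^+ 2 <= d * nsq y.
Proof.
move=> xd; set w := _ - _.
have [y0|y0] := eqVneq (nsq y) 0.
  by rewrite /w (nsq_eq0 y0) linear0r phi0 subrr expr0n/= /nsq linear0r mulr0.
have yp : 0 < nsq y by rewrite lt_def y0 nsq_ge0.
have := m_le (x + (- (w / nsq y))%:C *: y).
rewrite J_line -/w => h.
have {h xd} : J x < J x + 2 * - (w / nsq y) * w + (- (w / nsq y)) ^+ 2 * nsq y + d.
  by apply: lt_le_trans xd _; rewrite lerD2r.
rewrite (_ : _ + d = J x + (d - w ^+ 2 / nsq y)); last by field.
by rewrite ltrDl subr_gt0 ltr_pdivrMr// => /ltW.
Qed.

Let D (e : R) : set H := [set x | J x < m + e].

Let F : set_system H := filter_from [set e : R | 0 < e] D.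

Let F_proper : ProperFilter F.
Proof.
apply: filter_from_proper; last first.
  move=> e e0; have [_ [x _ <-] xe] := inf_adherent e0 has_infJ.
  by exists x.
apply: filter_from_filter; first by exists 1; rewrite /= ltr01.
move=> e f e0 f0; exists (Num.min e f); first by rewrite /= lt_min; apply/andP.
by move=> x; rewrite /D/= -ltrBlDl lt_min !ltrBlDl => /andP.
Qed.

Let ballR (x : H) (e : R) y : nsq (x - y) < e ^+ 2 -> 0 < e -> ball x e%:C y.
Proof.
move=> xy e0; rewrite -ball_normE /ball_/= normE ltcR.
by rewrite -(ger0_norm (ltW e0)) -sqrtr_sqr ltr_sqrt// exprn_gt0.
Qed.

Let F_cauchy : cauchy F.
Proof.
have FF := F_proper; apply: cauchy_exP => e e0.
have eR : (re e)%:C = e by rewrite RRe_real// gtr0_real.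
have e0' : 0 < re e by rewrite -ltcR eR.
have d0 : 0 < re e ^+ 2 / 4 by rewrite divr_gt0// exprn_gt0.
have [_ [x _ <-] xd] := inf_adherent d0 has_infJ.
exists x; exists (re e ^+ 2 / 4) => // y yd; rewrite -eR.
apply: ballR => //; rewrite mid.
have := m_le (2^-1%:C *: (x + y)); move: xd yd; rewrite /D/= -/m.
by move: m (J x) (J y) (J _) (re e ^+ 2) => *; lra.
Qed.

Let z := lim F.

Let near_z (d : R) : 0 < d -> exists2 x, J x < m + d & nsq (z - x) < d.
Proof.
move=> d0; have FF := F_proper; have Fz : F --> z by exact: cauchy_cvg.
have sd0 : 0 < (Num.sqrt d)%:C by rewrite ltcR sqrtr_gt0.
have F1 : F (ball z (Num.sqrt d)%:C) by apply: Fz; exact: nbhsx_ballx.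
have F2 : F (D d) by exists d.
have [x [xz xd]] := filter_ex (filterI F1 F2).
exists x => //; move: xz; rewrite -ball_normE /ball_/= normE ltcR.
by rewrite ltr_sqrt.
Qed.

Let z_re y : re (inner y z) = re (phi y).
Proof.
rewrite reC; apply/eqP; rewrite -subr_eq0; apply/negPn/negP.
set w := _ - _ => w0.
have w2 : 0 < w ^+ 2 by rewrite exprn_even_gt0.
have yp : 0 < nsq y.
  rewrite lt_def nsq_ge0 andbT; apply: contra w0 => /eqP/nsq_eq0 y0.
  by rewrite /w y0 linear0r phi0 subrr.
have d0 : 0 < w ^+ 2 / (8 * nsq y) by rewrite divr_gt0// mulr_gt0.
have [x xd zx] := near_z d0.
have H1 := near_min y xd; have H2 := re_CS (z - x) y.
have {}H2 : re (inner (z - x) y) ^+ 2 <= w ^+ 2 / (8 * nsq y) * nsq y.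
  by apply: (le_trans H2); rewrite ler_wpM2r// ltW.
have E : w ^+ 2 / (8 * nsq y) * nsq y = w ^+ 2 / 8 by field; rewrite gt_eqF.
rewrite E in H1 H2.
have : w = re (inner (z - x) y) + (re (inner x y) - re (phi y)).
  by rewrite linearBl reD reN /w; ring.
move: w2 H1 H2; move: (_ - re (phi y)) (re (inner (z - x) y)) (w) => p q v.
move=> v2 p2 q2 vE; have := sqr_ge0 (p - q); subst v.
rewrite !expr2 in v2 p2 q2 *; nra.
Qed.

Lemma Riesz : exists z, forall y, phi y = inner y z.
Proof.
exists z => y; apply/eqP; rewrite eq_complex; apply/andP; split.
  by rewrite z_re.
have := z_re ('i *: y); rewrite phiZ linearZl_LR/=.
by case: (inner y z) => ? ?; case: (phi y) => ? ?; rewrite /=; lra.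
Qed.

End Riesz.
(* C^n is written out with its Euclidean norm here, because the library norms
   'cV_n with the maximum of the entries. *)
Definition mx_numrange (C : numClosedFieldType) (n : nat) (S : 'M[C]_n) : set C :=
  [set \sum_i (S *m x) i 0 * conjC (x i 0) | x in [set x : 'cV_n | \sum_i `|x i 0| ^+ 2 = 1]].

Section Adjoint.
Variables (R : realType) (V W : hilbertType R) (A : boundedOp V W).

Lemma adjoint_exists :
  exists B : boundedOp W V, forall v w, inner (A v) w = inner v (B w).
Proof.
have [M M0 AM] := (bounded_nearP A).1 bounded_subproof.
have CS (x y : W) : `|inner x y| <= `|x| * `|y|.
  rewrite -ler_sqr ?nnegrE ?mulr_ge0// exprMn -!inner_norm.
  exact: dot_CauchySchwarz.
have ex w : {z | forall v, inner (A v) w = inner v z}.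
  apply: cid; apply: (@Riesz R V (fun v => inner (A v) w) (M * `|w|)).
  - by move=> k x y; rewrite linearP linearPl.
  - by rewrite mulr_ge0.
  - move=> x; apply: (le_trans (CS _ _)).
    by rewrite mulrAC ler_wpM2r// AM.
pose B w := sval (ex w).
have BE v w : inner (A v) w = inner v (B w) by rewrite /B; case: (ex w).
have Blin : linear B.
  move=> k x y; have E X : inner X (B (k *: x + y) - (k *: B x + B y)) = 0.
    by rewrite linearBr/= -BE !linearPr/= -!BE subrr.
  by apply/subr0_eq/eqP; rewrite -(dnorm_eq0 (@inner R V)) E.
have Bbd w : `|B w| <= M * `|w|.
  have [->|Bw] := eqVneq (B w) 0; first by rewrite normr0 mulr_ge0.
  rewrite -(ler_pM2l (x := `|B w|)) ?normr_gt0// -expr2 -inner_norm -BE.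
  rewrite -[leLHS]ger0_norm; last by rewrite BE dnorm_ge0.
  apply: (le_trans (CS _ _)); rewrite mulrA ler_wpM2r//.
  by rewrite mulrC AM.
pose Bl : {linear W -> V} := HB.pack B (GRing.isLinear.Build _ _ _ _ B Blin).
have Bn : bounded_near Bl (nbhs (0 : W)) by apply/bounded_nearP; exists M.
pose Bb : boundedOp W V := HB.pack B (isBounded.Build _ _ _ B Bn) Bl.
by exists Bb.
Qed.

Definition adjoint : boundedOp W V := sval (cid adjoint_exists).

Lemma adjointP v w : inner (A v) w = inner v (adjoint w).
Proof. by rewrite /adjoint; case: cid. Qed.

End Adjoint.

Section BlockOperator.
Variables (R : realType) (H K : hilbertType R) (a b c : R[i]).
Variable A : boundedOp K H.

Definition blockop (u : hsum H K) : hsum H K :=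
  (a *: u.1 + A u.2, c *: adjoint A u.1 + b *: u.2).

Lemma blockop_linear : linear blockop.
Proof.
move=> k [x1 x2] [y1 y2]; congr pair; rewrite /=.
  by rewrite (linearP A) scalerDr (scalerDr k) !scalerA (mulrC a) addrACA.
rewrite (linearP (adjoint A)) !scalerDr !scalerA (mulrC b) (mulrC c).
by rewrite addrACA.
Qed.

HB.instance Definition _ := GRing.isLinear.Build R[i] (hsum H K) (hsum H K) _
  blockop blockop_linear.

Lemma blockop_bounded : bounded_near blockop (nbhs (0 : hsum H K)).
Proof.
apply/bounded_nearP.
have [M M0 AM] := (bounded_nearP A).1 bounded_subproof.
have [N N0 BN] := (bounded_nearP (adjoint A)).1 bounded_subproof.
exists ((`|a| + M) + (`|c| * N + `|b|)).
  by rewrite !addr_ge0// mulr_ge0.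
move=> u; apply: (le_trans (hsum_norm_le _)); rewrite mulrDl lerD//=.
- apply: (le_trans (ler_normD _ _)); rewrite mulrDl lerD//.
    by rewrite normrZ ler_wpM2l// hsum_norm_fst.
  by apply: (le_trans (AM _)); rewrite ler_wpM2l// hsum_norm_snd.
- apply: (le_trans (ler_normD _ _)); rewrite mulrDl lerD//.
    rewrite normrZ -mulrA ler_wpM2l//; apply: (le_trans (BN _)).
    by rewrite ler_wpM2l// hsum_norm_fst.
  by rewrite normrZ ler_wpM2l// hsum_norm_snd.
Qed.

HB.instance Definition _ :=
  isBounded.Build R[i] (hsum H K) (hsum H K) blockop blockop_bounded.

End BlockOperator.

Definition block2 (C : nzRingType) (a b c t : C) : 'M[C]_2 :=
  block_mx a%:M t%:M (c * t)%:M b%:M : 'M_(1 + 1).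

(* Main.v *)
Require Import Defs.
From HB Require Import structures.
From mathcomp Require Import all_boot all_order all_algebra.
From mathcomp Require Import complex.
From mathcomp Require Import boolp classical_sets reals topology normedtype.
From mathcomp Require Import ring lra.

(** Both halves of the theorem reduce the infinite-dimensional data of a unit
    vector (x, y) to a few numbers.

    Numerical range.  For |x|^2 + |y|^2 = 1, put p = |x|^2 and z = <Ay, x>; then
    <T(x, y), (x, y)> = b + (a - b) p + z + c z^*, the value [form_value p z]
    ([inner_blockop]).  For the matrix S_t the points (p, z) that occur form
    exactly the ellipsoid |z|^2 = t^2 p (1 - p) in R x C
    ([mem_numrange_block2]).  The form value is an affine map from a real space
    of dimension 3 to one of dimension 2, so its linear part has a kernel
    vector; moving along it from a point of the solid ellipsoid, one reaches the
    surface without changing the value ([form_value_surface]).  Hence surface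
    and solid have the same image, and W(S_t) increases with t.  Since
    |z| <= |Ay| |x|, every value of T lies in W(S_t) for any t > 0 with
    |Ay| <= t |y|; conversely a unit vector y with A y <> 0, together with the
    direction of A y, spans a copy of C^2 on which T compresses to S_|Ay|, so
    W(S_|Ay|) is contained in W(T) ([numrange_block2_sub]).  If A attains its
    norm d, the value t = d can be used throughout; otherwise |Ay| < d |y| for
    all y <> 0, whereas |Ay| comes arbitrarily close to d on unit vectors, and
    this gives the union over t < d.  That union is never W(S_d): in a suitable
    direction the support function of W(S_t) is strictly increasing at t = d, so
    W(S_d) has a point outside every W(S_t) with t < d
    ([numrange_block2_strict]).

    Norm.  If |Ay| <= t |y| and |A^* x| <= t |x|, then |T(x, y)|^2 is at most a
    real quadratic form [normform t] in (|x|, |y|), and the compression argument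
    shows that t = |Ay|, for a unit vector y, gives a form whose values are all
    dominated by values of |T u|^2 ([rnorm_blockop_le], [rnorm_blockop_ge]).  So
    if A attains its norm, a maximiser of [normform d] on the unit circle gives
    a vector at which T attains its norm.  If A does not, then neither does its
    adjoint, so at any unit vector u one has |T u|^2 <= [normform t] for some
    t < d, and this is strictly below the maximum of [normform t'] for a
    t' = |Ay| in (t, d) ([normform_lt]); hence T does not attain its norm
    at u. *)

Set Implicit Arguments.
Unset Strict Implicit.
Unset Printing Implicit Defensive.

Import Order.TTheory GRing.Theory Num.Theory.
Import numFieldNormedType.Exports.

Local Open Scope classical_set_scope.
Local Open Scope ring_scope.
Local Open Scope complex_scope.

(** * Real quadratic forms on the quarter circle *)

Lemma quadratic_root (R : rcfType) (k l m : R) :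
  0 < k -> m <= 0 -> exists x, k * x ^+ 2 + 2 * l * x + m = 0.
Proof.
move=> k0 m0; have D0 : 0 <= l ^+ 2 - k * m.
  by rewrite addr_ge0 ?sqr_ge0// -mulrN mulr_ge0 ?oppr_ge0// ltW.
exists ((Num.sqrt (l ^+ 2 - k * m) - l) / k).
have k_neq0 : k != 0 by rewrite gt_eqF.
rewrite [LHS](_ : _ = (Num.sqrt (l ^+ 2 - k * m) ^+ 2 - l ^+ 2 + k * m) / k).
  by rewrite sqr_sqrtr//; field.
by field.
Qed.

Definition qform (R : rcfType) (alpha beta gamma r s : R) : R :=
  alpha * r ^+ 2 + beta * s ^+ 2 + 2 * gamma * (r * s).

(** The maximum is the largest eigenvalue lambda of the symmetric matrix: with
    p^2 = lambda - alpha, q^2 = lambda - beta and p q = gamma, the form equals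
    lambda (r^2 + s^2) - (p r - q s)^2, so it is maximal on the ray of (q, p).
    If gamma > 0 this ray is interior to the quadrant, which is why a smaller
    coefficient gamma' stays strictly below lambda even at the two points of the
    quarter circle where r s = 0 and the forms agree. *)
Lemma qform_max (R : rcfType) (alpha beta gamma : R) : 0 <= gamma ->
  exists lambda r s, [/\ [/\ 0 <= r, 0 <= s & r ^+ 2 + s ^+ 2 = 1],
    qform alpha beta gamma r s = lambda,
    forall r' s', qform alpha beta gamma r' s' <= lambda * (r' ^+ 2 + s' ^+ 2)
    & forall gamma' r' s', 0 <= gamma' < gamma -> 0 <= r' -> 0 <= s' ->
        r' ^+ 2 + s' ^+ 2 = 1 -> qform alpha beta gamma' r' s' < lambda].
Proof.
move=> g0.
have [P [Q [P0 Q0 PQ QP]]] : exists P Q : R,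
    [/\ 0 <= P, 0 <= Q, P * Q = gamma ^+ 2 & alpha + P = beta + Q].
  (* P and Q are lambda - alpha and lambda - beta. *)
  pose D := Num.sqrt ((alpha - beta) ^+ 2 + 4 * gamma ^+ 2).
  have D2 : D ^+ 2 = (alpha - beta) ^+ 2 + 4 * gamma ^+ 2.
    by rewrite sqr_sqrtr// addr_ge0 ?sqr_ge0 ?mulr_ge0 ?ler0n ?sqr_ge0.
  have D0 : 0 <= D := sqrtr_ge0 _.
  have : `|alpha - beta| <= D.
    rewrite -ler_sqr ?nnegrE// real_normK ?num_real// D2 lerDl.
    by rewrite mulr_ge0 ?sqr_ge0 ?ler0n.
  rewrite ler_norml => /andP[D1 D3].
  exists ((D - (alpha - beta)) / 2), ((D + (alpha - beta)) / 2).
  by split; lra.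
pose p := Num.sqrt P; pose q := Num.sqrt Q.
have p0 : 0 <= p := sqrtr_ge0 _. have q0 : 0 <= q := sqrtr_ge0 _.
have p2 : p ^+ 2 = P by rewrite sqr_sqrtr.
have q2 : q ^+ 2 = Q by rewrite sqr_sqrtr.
have pq : p * q = gamma.
  by apply/eqP; rewrite -(@eqrXn2 _ 2) ?mulr_ge0// exprMn p2 q2 PQ.
have E r s : qform alpha beta gamma r s =
    (alpha + P) * (r ^+ 2 + s ^+ 2) - (p * r - q * s) ^+ 2.
  rewrite mulrDr {2}QP /qform -pq -p2 -q2; ring.
have [r [s [rs0 rs]]] : exists r s, [/\ 0 <= r, 0 <= s & r ^+ 2 + s ^+ 2 = 1]
    /\ p * r - q * s = 0.
  have [pq0|pq0] := eqVneq (p ^+ 2 + q ^+ 2) 0.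
    move/eqP: pq0; rewrite paddr_eq0 ?sqr_ge0// !sqrf_eq0 => /andP[/eqP-> /eqP->].
    by exists 1, 0; rewrite !mul0r subrr expr1n expr0n addr0 ler01 lexx.
  pose N := Num.sqrt (p ^+ 2 + q ^+ 2).
  have N2 : N ^+ 2 = p ^+ 2 + q ^+ 2 by rewrite sqr_sqrtr// addr_ge0 ?sqr_ge0.
  have N0 : N != 0 by rewrite -sqrf_eq0 N2.
  exists (q / N), (p / N); split; last by field.
  rewrite !divr_ge0 ?sqrtr_ge0//; split=> //.
  by rewrite !expr_div_n -mulrDl addrC -N2 divff// sqrf_eq0.
exists (alpha + P), r, s; split=> //.
- by case: rs0 => _ _ rs1; rewrite E rs rs1 expr0n/= mulr1 subr0.
- by move=> r' s'; rewrite E gerBl sqr_ge0.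
- move=> gamma' r' s' /andP[g0' gg'] r0 s0 rs1.
  (* The gap is (p r' - q s')^2 + 2 (gamma - gamma') r' s'; both terms can only
     vanish at the origin, since p and q are positive. *)
  have -> : qform alpha beta gamma' r' s' =
      qform alpha beta gamma r' s' - 2 * (gamma - gamma') * (r' * s').
    by rewrite /qform; ring.
  rewrite E rs1 mulr1 -addrA -opprD gtrBl.
  have gB : 0 < 2 * (gamma - gamma') by rewrite mulr_gt0// subr_gt0.
  have pq0 : 0 < p * q by rewrite pq (le_lt_trans g0').
  have rs_ge0 : 0 <= r' * s' by rewrite mulr_ge0.
  have [rs'0|rs'N] := eqVneq (r' * s') 0; last first.
    by rewrite ltr_wpDl ?sqr_ge0// mulr_gt0// lt_def rs'N.
  rewrite rs'0 mulr0 addr0 exprn_even_gt0//=; apply/eqP => pqE.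
  have : (p * r' - q * s') ^+ 2 + 2 * (p * q) * (r' * s') = 0.
    by rewrite pqE rs'0 mulr0 expr0n addr0.
  rewrite (_ : _ + _ = (p * r') ^+ 2 + (q * s') ^+ 2); last by ring.
  move/eqP; rewrite paddr_eq0 ?sqr_ge0// !sqrf_eq0 !mulf_eq0.
  move: pq0; rewrite lt_def mulf_eq0 negb_or -andbA => /and3P[/negPf-> /negPf-> _].
  move=> /andP[/eqP r'0 /eqP s'0]; move/eqP: rs1.
  by rewrite r'0 s'0 expr0n addr0 eq_sym oner_eq0.
Qed.

Lemma ler_qform (R : rcfType) (alpha beta gamma alpha' beta' gamma' r s : R) :
  0 <= r -> 0 <= s -> alpha <= alpha' -> beta <= beta' -> gamma <= gamma' ->
  qform alpha beta gamma r s <= qform alpha' beta' gamma' r s.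
Proof.
move=> r0 s0 al be ga; rewrite /qform !lerD// ler_wpM2r ?sqr_ge0 ?mulr_ge0//.
by rewrite ler_wpM2l.
Qed.

(** * Real-valued norms and phases *)

Section RealNorm.
Variable R : realType.
Implicit Types (V : normedZmodType R[i]) (W : normedModType R[i]) (z : R[i]).

(** Norms over R[i] take values in R[i]; inequalities and squares are easier to
    handle for the underlying real number. *)
Definition rnorm V (x : V) : R := complex.Re `|x|.

Lemma rnormE V (x : V) : `|x| = (rnorm x)%:C.
Proof. by rewrite RRe_real// normr_real. Qed.

Lemma rnorm_ge0 V (x : V) : 0 <= rnorm x.
Proof. by rewrite -lecR -rnormE normr_ge0. Qed.

Lemma rnorm0 V : rnorm (0 : V) = 0.
Proof. by rewrite /rnorm normr0. Qed.

Lemma rnorm_eq0 V (x : V) : (rnorm x == 0) = (x == 0).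
Proof. by rewrite -(inj_eq (@complexI R)) -rnormE normr_eq0. Qed.

Lemma rnorm_gt0 V (x : V) : (0 < rnorm x) = (x != 0).
Proof. by rewrite lt_def rnorm_ge0 andbT rnorm_eq0. Qed.

Lemma norm_eq1 V (x : V) : `|x| = 1 <-> rnorm x = 1.
Proof. by rewrite rnormE; split=> [/complexI|->]. Qed.

Lemma rnormZ W (k : R[i]) (x : W) : rnorm (k *: x) = rnorm k * rnorm x.
Proof. by apply: (@complexI R); rewrite rmorphM/= -!rnormE normrZ. Qed.

Lemma rnormM z1 z2 : rnorm (z1 * z2) = rnorm z1 * rnorm z2.
Proof. by apply: (@complexI R); rewrite rmorphM/= -!rnormE normrM. Qed.

Lemma rnormR (t : R) : 0 <= t -> rnorm t%:C = t.
Proof. by move=> t0; apply: (@complexI R); rewrite -rnormE ger0_norm// lecR. Qed.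

Lemma rnorm_conj z : rnorm (z^*)%R = rnorm z.
Proof. by rewrite /rnorm norm_conjC. Qed.

Lemma sqr_rnorm z : rnorm z ^+ 2 = complex.Re z ^+ 2 + complex.Im z ^+ 2.
Proof. by apply: (@complexI R); rewrite rmorphXn/= -rnormE -add_Re2_Im2. Qed.

Lemma conjD z1 z2 : ((z1 + z2)^*)%R = (z1^*)%R + (z2^*)%R.
Proof. exact: rmorphD. Qed.

Lemma conjB z1 z2 : ((z1 - z2)^*)%R = (z1^*)%R - (z2^*)%R.
Proof. exact: rmorphB. Qed.

Lemma conjM z1 z2 : ((z1 * z2)^*)%R = (z1^*)%R * (z2^*)%R.
Proof. exact: rmorphM. Qed.

Lemma conjR (t : R) : (t%:C^*)%R = t%:C.
Proof. exact: conjc_real. Qed.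

Lemma mul_conjC z : z * (z^*)%R = (rnorm z ^+ 2)%:C.
Proof. by rewrite -normCK rnormE rmorphXn. Qed.

Lemma Re_le_rnorm z : complex.Re z <= rnorm z.
Proof. by rewrite -lecR -rnormE complexRe; exact: (leif_Re_Creal z).1. Qed.

Lemma exists_phase z : exists e : R[i], rnorm e = 1 /\ z = (rnorm z)%:C * e.
Proof.
have [->|z0] := eqVneq z 0.
  by exists 1; rewrite rnorm0 mul0r; split=> //; rewrite /rnorm normr1.
have rz0 : (rnorm z)%:C != 0 by rewrite -rnormE normr_eq0.
exists ((rnorm z)^-1%:C * z); split.
  by rewrite rnormM rnormR ?invr_ge0 ?rnorm_ge0// mulVf// rnorm_eq0.
by rewrite mulrA -rmorphM/= mulfV ?rnorm_eq0// mul1r.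
Qed.

(** The equation alone forces 0 <= p <= 1, so that p = r^2 and 1 - p = s^2
    parametrise the unit vectors of C^2 up to a common phase. *)
Lemma sphere_coordinates (t p : R) z : 0 < t ->
  rnorm z ^+ 2 = t ^+ 2 * (p * (1 - p)) ->
  exists r s e, [/\ 0 <= r, 0 <= s, r ^+ 2 = p & s ^+ 2 = 1 - p] /\
    (rnorm e = 1 /\ z = (t * r * s)%:C * e).
Proof.
move=> t0 zp; have t2 : 0 < t ^+ 2 by rewrite exprn_gt0.
have pp : 0 <= p * (1 - p) by rewrite -(pmulr_rge0 _ t2) -zp sqr_ge0.
have p0 : 0 <= p by nra.
have p1 : 0 <= 1 - p by nra.
have [e [e1 zE]] := exists_phase z.
exists (Num.sqrt p), (Num.sqrt (1 - p)), e.
rewrite !sqrtr_ge0 !sqr_sqrtr//; split=> //; split=> //.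
rewrite zE; congr (_%:C * _); apply/eqP.
rewrite -(@eqrXn2 _ 2) ?rnorm_ge0 ?mulr_ge0 ?sqrtr_ge0 ?ltW//.
by rewrite zp !exprMn !sqr_sqrtr// mulrA.
Qed.

End RealNorm.

(** * The numerical range of a 2 x 2 matrix *)

Section NumericalRange2.
Variables (R : realType) (a b c : R[i]).

(** The value <Sx, x> at a unit vector, as a function of p = |x_1|^2 and of
    z = t x_2 x_1^*, which are all that it depends on. *)
Definition form_value (p : R) (z : R[i]) : R[i] :=
  b + (a - b) * p%:C + z + c * (z^*)%R.

(** A real linear map from R x C to C has a nonzero kernel vector.  When
    |c| <> 1 the map z |-> z + c z^* is invertible and p can be prescribed;
    when |c| = 1 it has a kernel of its own. *)
Lemma form_value_kernel : exists (p : R) (z : R[i]),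
  0 < p ^+ 2 + rnorm z ^+ 2 /\ (a - b) * p%:C + z + c * (z^*)%R = 0.
Proof.
have [c1|c1] := eqVneq (rnorm c) 1; last first.
  exists (1 - rnorm c ^+ 2), (c * ((a - b)^*)%R - (a - b)); split.
    rewrite ltr_wpDr ?sqr_ge0// exprn_even_gt0//= subr_eq0 eq_sym.
    by rewrite -[X in _ == X](expr1n _ 2) eqrXn2 ?rnorm_ge0.
  have -> : (1 - rnorm c ^+ 2)%:C = 1 - c * (c^*)%R.
    by rewrite mul_conjC rmorphB rmorph1.
  by rewrite !(conjB, conjM, conjCK); ring.
exists 0.
have [cE|cN] := eqVneq c 1.
  exists 'i; split; first by rewrite sqr_rnorm/= expr0n !add0r expr1n ltr01.
  by rewrite cE mul1r mulr0 add0r; apply/eqP; rewrite eq_complex/= addr0 subrr eqxx.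
exists (1 - c); split.
  by rewrite expr0n add0r exprn_gt0// rnorm_gt0 subr_eq0 eq_sym.
by rewrite mulr0 conjB (rmorph1 Num.conj) mulrBr mul_conjC c1 expr1n; ring.
Qed.

(** The line through (p, z) in the direction of a kernel vector starts in the
    solid ellipsoid, which is bounded, so it meets the surface; the parameter of
    the meeting point is a root of a quadratic polynomial that is nonpositive
    at 0. *)
Lemma form_value_surface (t p : R) (z : R[i]) : 0 < t ->
  rnorm z ^+ 2 <= t ^+ 2 * (p * (1 - p)) ->
  exists p' z', rnorm z' ^+ 2 = t ^+ 2 * (p' * (1 - p')) /\
    form_value p' z' = form_value p z.
Proof.
move=> t0 zp; have [q [v [v0 qv]]] := form_value_kernel.
have [x xE] : exists x, (t ^+ 2 * q ^+ 2 + rnorm v ^+ 2) * x ^+ 2 +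
    2 * (complex.Re z * complex.Re v + complex.Im z * complex.Im v
         + t ^+ 2 * (q * p - q / 2)) * x
    + (rnorm z ^+ 2 - t ^+ 2 * (p * (1 - p))) = 0.
  apply: quadratic_root; last by rewrite subr_le0.
  have t2 : 0 < t ^+ 2 by rewrite exprn_gt0.
  have [q0|q0] := eqVneq q 0.
    by move: v0; rewrite q0 expr0n/= add0r mulr0 add0r.
  by rewrite ltr_pwDl ?sqr_ge0// mulr_gt0// exprn_even_gt0.
exists (p + x * q), (z + x%:C * v); split.
  apply/eqP; rewrite -subr_eq0 -xE !sqr_rnorm; apply/eqP.
  by case: (z) (v) => z1 z2 [v1 v2] /=; field.
apply/eqP; rewrite -subr_eq0 -[X in _ == X](mulr0 x%:C) -qv; apply/eqP.
rewrite /form_value (rmorphD (real_complex R)) (rmorphM (real_complex R))/=.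
by rewrite conjD conjM conjR; ring.
Qed.

Lemma block2_formE (t : R[i]) (x : 'cV[R[i]]_2) :
  \sum_i (block2 a b c t *m x) i 0 * ((x i 0)^*)%R =
  (a * x 0 0 + t * x 1 0) * ((x 0 0)^*)%R
  + (c * t * x 0 0 + b * x 1 0) * ((x 1 0)^*)%R.
Proof.
have sc (k : R[i]) : (k%:M : 'M_1) 0 0 = k by rewrite mxE eqxx.
pose i0 : 'I_2 := lshift 1 (0 : 'I_1); pose i1 : 'I_2 := rshift 1 (0 : 'I_1).
have E0 : i0 = 0 by apply: val_inj.
have E1 : i1 = 1 by apply: val_inj.
have E1' : i1 = lift ord0 ord0 by apply: val_inj.
have B00 : block2 a b c t i0 i0 = a
  by apply: etrans (block_mxEul _ _ _ _ _ _) (sc _).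
have B01 : block2 a b c t i0 i1 = t
  by apply: etrans (block_mxEur _ _ _ _ _ _) (sc _).
have B10 : block2 a b c t i1 i0 = c * t
  by apply: etrans (block_mxEdl _ _ _ _ _ _) (sc _).
have B11 : block2 a b c t i1 i1 = b
  by apply: etrans (block_mxEdr _ _ _ _ _ _) (sc _).
rewrite E0 in B00 B01 B10.
rewrite !big_ord_recl big_ord0 addr0 !mxE !big_ord_recl !big_ord0 !addr0.
by rewrite -E1' -E1 B00 B01 B10 B11.
Qed.

Lemma mem_numrange_block2 (t : R) (w : R[i]) : 0 < t ->
  mx_numrange (block2 a b c t%:C) w <->
  exists p z, rnorm z ^+ 2 = t ^+ 2 * (p * (1 - p)) /\ w = form_value p z.
Proof.
move=> t0; split.
  move=> [x]; move: (x : 'cV[R[i]]_2) => {}x /= x1 <-; rewrite block2_formE.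
  have {x1} : rnorm (x 0 0 : R[i]) ^+ 2 + rnorm (x 1 0 : R[i]) ^+ 2 = 1.
    apply: (@complexI R); rewrite rmorphD !rmorphXn/= -!rnormE -[RHS]x1.
    rewrite !big_ord_recl big_ord0 addr0; congr (`|x _ _| ^+ 2 + `|x _ _| ^+ 2).
    exact: val_inj.
  move: (x 0 0 : R[i]) (x 1 0 : R[i]) => u v uv.
  exists (rnorm u ^+ 2), (t%:C * v * (u^*)%R); split.
    by rewrite !rnormM rnorm_conj rnormR ?ltW// -[1 in RHS]uv; ring.
  rewrite /form_value !conjM conjCK conjR -mul_conjC.
  have uvC : u * (u^*)%R + v * (v^*)%R = 1.
    by rewrite !mul_conjC -rmorphD uv rmorph1.
  by rewrite -[X in _ = X + _ * _ + _ + _]mulr1 -uvC; ring.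
move=> [p [z [zp ->]]].
have [r [s [e [[r0 s0 r2 s2] [e1 zE]]]]] := sphere_coordinates t0 zp.
exists (\col_i if i == 0 then r%:C else s%:C * e).
  rewrite /= !big_ord_recl big_ord0 addr0 !mxE/= !rnormE rnormM e1 mulr1.
  by rewrite !rnormR// -!rmorphXn -rmorphD/= r2 s2 addrC subrK.
rewrite block2_formE !mxE/= /form_value zE.
rewrite !(rmorphM (real_complex R))/= !conjM !conjR.
have -> : p%:C = r%:C ^+ 2 by rewrite -r2 rmorphXn.
have rsC : r%:C ^+ 2 + s%:C ^+ 2 * (e * (e^*)%R) = 1.
  by rewrite mul_conjC e1 expr1n mulr1 -!rmorphXn -rmorphD/= r2 s2 addrC subrK.
by rewrite -[X in _ = X + _ * _ + _ + _]mulr1 -rsC; ring.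
Qed.

(** This contains the Toeplitz-Hausdorff theorem for these matrices: W(S_t) is
    the image of a convex set under an affine map. *)
Lemma numrange_block2_solid (t p : R) z : 0 < t ->
  rnorm z ^+ 2 <= t ^+ 2 * (p * (1 - p)) ->
  mx_numrange (block2 a b c t%:C) (form_value p z).
Proof.
move=> t0 /(form_value_surface t0)[p' [z' [zp' <-]]].
by apply/mem_numrange_block2 => //; exists p', z'.
Qed.

Lemma numrange_block2_mono (t t' : R) : 0 < t -> t <= t' ->
  mx_numrange (block2 a b c t%:C) `<=` mx_numrange (block2 a b c t'%:C).
Proof.
move=> t0 tt' w /(mem_numrange_block2 _ t0)[p [z [zp ->]]].
apply: numrange_block2_solid; first exact: lt_le_trans tt'.
have pp : 0 <= p * (1 - p).
  by rewrite -(@pmulr_rge0 _ (t ^+ 2)) ?exprn_gt0// -zp sqr_ge0.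
by rewrite zp ler_wpM2r// ler_sqr ?nnegrE// ltW// (lt_le_trans t0).
Qed.

End NumericalRange2.

(** * Strictness of the inclusions between numerical ranges *)

Section StrictInclusion.
Variables (R : realType) (a b c : R[i]).

(** A direction e in which the support function of W(S_t) depends on t: there
    e (z + c z^* ) and m z have the same real part, for m = e + (e c)^* .  The
    direction e = 1 works unless c = -1, when e = 'i gives m = 2 'i. *)
Lemma Re_form_value : exists e m : R[i], m != 0 /\
  forall p z, complex.Re (e * form_value a b c p z) =
    complex.Re (e * b) + complex.Re (e * (a - b)) * p + complex.Re (m * z).
Proof.
have ReE (e : R[i]) p z : complex.Re (e * form_value a b c p z) =
    complex.Re (e * b) + complex.Re (e * (a - b)) * p
    + complex.Re ((e + ((e * c)^*)%R) * z).
  rewrite /form_value; case: a b c e z => [a1 a2] [b1 b2] [c1 c2] [e1 e2] [z1 z2] /=.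
  ring.
have [m0|m0] := eqVneq (1 + ((1 * c)^*)%R) 0; last first.
  by exists 1, (1 + ((1 * c)^*)%R).
exists 'i, ('i + (('i * c)^*)%R); split; last exact: ReE.
have -> : c = -1.
  rewrite mul1r in m0.
  by rewrite -[c]conjCK -[(c^*)%R](addKr 1) m0 addr0 rmorphN rmorph1.
rewrite eq_complex negb_and /=; apply/orP; right; apply/eqP; lra.
Qed.

(** The point of W(S_d) maximising the functional of the previous lemma.  With
    p = r^2 and |z| = t r s, the largest value of the functional for given p is
    a quadratic form in (r, s) whose mixed coefficient |m| t / 2 increases
    strictly with t, so the maximum over the circle does too. *)
Lemma numrange_block2_strict (d : R) : 0 < d ->
  exists w, mx_numrange (block2 a b c d%:C) w /\
    forall t, 0 < t < d -> ~ mx_numrange (block2 a b c t%:C) w.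
Proof.
move=> d0; have [e [m [m0 ReE]]] := Re_form_value.
have m_gt0 : 0 < rnorm m by rewrite rnorm_gt0.
pose alpha := complex.Re (e * (a - b)); pose gamma t := rnorm m * t / 2.
have gamma_ge0 t : 0 <= t -> 0 <= gamma t.
  by move=> t_ge0; rewrite /gamma divr_ge0// mulr_ge0// rnorm_ge0.
have [la [r [s [[r0 s0 rs1] laE _ laS]]]] :=
  qform_max alpha 0 (gamma_ge0 _ (ltW d0)).
have [u [u1 mE]] := exists_phase m.
have sE : 1 - r ^+ 2 = s ^+ 2 by rewrite -rs1 addrC addKr.
(* The phase u^* aligns m z with the positive real axis. *)
exists (form_value a b c (r ^+ 2) ((d * r * s)%:C * (u^*)%R)); split.
  apply: numrange_block2_solid => //.
  rewrite rnormM rnorm_conj u1 mulr1 rnormR ?mulr_ge0 ?(ltW d0)//.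
  by rewrite sE !exprMn mulrA.
move=> t /andP[t0 td] /(mem_numrange_block2 _ _ _ _ t0)[p [z [zp wE]]].
have [r' [s' [u' [[r0' s0' r2 s2] [u1' zE]]]]] := sphere_coordinates t0 zp.
have rs1' : r' ^+ 2 + s' ^+ 2 = 1 by rewrite r2 s2 addrC subrK.
have := congr1 (fun w => complex.Re (e * w)) wE; rewrite /= !ReE -!addrA.
move=> /addrI; apply/eqP; rewrite gt_eqF//.
have -> : complex.Re (m * ((d * r * s)%:C * (u^*)%R)) = rnorm m * (d * r * s).
  rewrite {1}mE mulrACA mul_conjC u1 expr1n mulr1 -rmorphM//=.
have Rz : complex.Re (m * z) <= rnorm m * (t * r' * s').
  apply: (le_trans (Re_le_rnorm _)); rewrite zE !rnormM u1' mulr1.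
  by rewrite rnormR// !mulr_ge0// ltW.
have gtd : 0 <= gamma t < gamma d.
  by rewrite gamma_ge0 ?ltW//= /gamma ltr_pM2r ?invr_gt0// ltr_pM2l.
have := laS (gamma t) r' s' gtd r0' s0' rs1'.
rewrite -laE /qform /gamma -/alpha => laS'.
rewrite -r2; nra.
Qed.

End StrictInclusion.

(** * The operator norm and its attainment *)

Section OperatorNormTheory.
Variables (R : realType) (V W : normedModType R[i]) (f : boundedOp V W).

Let has_sup_opnorm : has_sup [set complex.Re `|f x| | x in [set x | `|x| <= 1]].
Proof.
split; first by exists (rnorm (f 0)), 0 => //=; rewrite normr0 ler01.
have [M M0 fM] := (bounded_nearP f).1 bounded_subproof.
exists (complex.Re M) => _ [x /= x1 <-].
rewrite -lecR -/(rnorm (f x)) -rnormE RRe_real ?ger0_real//.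
by apply: (le_trans (fM x)); rewrite ler_piMr.
Qed.

Lemma opnorm_ge0 : 0 <= opnorm f.
Proof.
apply: (le_trans (rnorm_ge0 (f 0))); apply: sup_upper_bound => //.
by exists 0 => //=; rewrite normr0 ler01.
Qed.

Lemma rnorm_le_opnorm x : rnorm (f x) <= opnorm f * rnorm x.
Proof.
have [->|x0] := eqVneq x 0; first by rewrite linear0 !rnorm0 mulr0.
have x_gt0 : 0 < rnorm x by rewrite rnorm_gt0.
rewrite -ler_pdivrMr// mulrC -[X in X * _](@rnormR R) ?invr_ge0 ?rnorm_ge0//.
rewrite -rnormZ -linearZ; apply: sup_upper_bound => //.
exists ((rnorm x)^-1%:C *: x) => //=.
rewrite rnormE rnormZ rnormR ?invr_ge0 ?rnorm_ge0//.
by rewrite mulVf// gt_eqF.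
Qed.

Lemma opnorm_approx t : 0 <= t < opnorm f ->
  exists x, rnorm x = 1 /\ t < rnorm (f x).
Proof.
move=> /andP[t0 td].
have e0 : 0 < opnorm f - t by rewrite subr_gt0.
have [_ [x /= x1 <-]] := sup_adherent e0 has_sup_opnorm.
rewrite -/(opnorm f) subKr => tx.
have x_gt0 : 0 < rnorm x.
  rewrite rnorm_gt0; apply: contraTneq tx => ->.
  by rewrite linear0 normr0 -leNgt.
exists ((rnorm x)^-1%:C *: x).
rewrite linearZ !rnormZ rnormR ?invr_ge0 ?rnorm_ge0// mulVf ?gt_eqF//; split=> //.
apply: (lt_le_trans tx); rewrite ler_peMl ?rnorm_ge0//.
by rewrite invf_ge1// -lecR -rnormE.
Qed.

Lemma attains_normE : attains_norm f <->
  exists x, rnorm x = 1 /\ rnorm (f x) = opnorm f.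
Proof.
split=> -[x [x1 fx]]; exists x.
  by split; [exact/norm_eq1|apply: complexI; rewrite -rnormE].
by split; [exact/norm_eq1|rewrite rnormE fx].
Qed.

(** Attainment without mention of the operator norm, so that the norm of the
    block operator never has to be computed. *)
Lemma attains_normP : attains_norm f <->
  exists x, rnorm x = 1 /\ forall y, rnorm (f y) <= rnorm (f x) * rnorm y.
Proof.
split=> [/attains_normE[x [x1 fx]]|[x [x1 fx]]].
  by exists x; split=> // y; rewrite fx rnorm_le_opnorm.
apply/attains_normE; exists x; split=> //.
apply/eqP; rewrite eq_le; apply/andP; split.
  by have := rnorm_le_opnorm x; rewrite x1 mulr1.
rewrite leNgt; apply/negP => fx_lt.
have [|y [y1]] := @opnorm_approx (rnorm (f x)); first by rewrite rnorm_ge0.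
by apply/negP; rewrite -leNgt (le_trans (fx y))// y1 mulr1.
Qed.

Lemma not_attains_lt x : ~ attains_norm f -> x != 0 ->
  rnorm (f x) < opnorm f * rnorm x.
Proof.
move=> nf x0; rewrite lt_neqAle rnorm_le_opnorm andbT; apply/eqP => fx.
have x_neq0 : rnorm x != 0 by rewrite rnorm_eq0.
apply/nf/attains_normE; exists ((rnorm x)^-1%:C *: x).
rewrite linearZ !rnormZ rnormR ?invr_ge0 ?rnorm_ge0// mulVf//; split=> //.
by rewrite fx mulrC mulfK.
Qed.

End OperatorNormTheory.

(** * Inner products and the adjoint *)

Section HilbertTheory.
Variable R : realType.
Implicit Types H K : hilbertType R.

Lemma inner_sqr H (x : H) : inner x x = (rnorm x ^+ 2)%:C.
Proof. by rewrite inner_norm rnormE rmorphXn. Qed.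

Lemma inner_conj H (x y : H) : inner y x = ((inner x y)^*)%R.
Proof. by rewrite (hermC (@inner R H)) mul1r. Qed.

Lemma CauchySchwarz H (x y : H) : rnorm (inner x y) <= rnorm x * rnorm y.
Proof.
rewrite -ler_sqr ?nnegrE ?mulr_ge0 ?rnorm_ge0// -lecR.
have := dot_CauchySchwarz (@inner R H) x y.
by rewrite !inner_sqr exprMn -rmorphM/= rnormE -rmorphXn.
Qed.

Lemma sqr_rnormD H (x y : H) : rnorm (x + y) ^+ 2 =
  rnorm x ^+ 2 + rnorm y ^+ 2 + 2 * complex.Re (inner x y).
Proof.
apply: (@complexI R); rewrite -inner_sqr dnormD !inner_sqr.
rewrite !(rmorphD (real_complex R)).
congr (_ + _ + _); case: (inner x y) => u v /=.
by apply/eqP; rewrite eq_complex/=; apply/andP; split; apply/eqP; ring.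
Qed.

Lemma innerZZ H (k l : R[i]) (x y : H) :
  inner (k *: x) (l *: y) = k * (l^*)%R * inner x y.
Proof. by rewrite linearZl_LR linearZr_LR/= mulrA. Qed.

Section AdjointNorm.
Variables (H K : hilbertType R) (A : boundedOp K H).

Lemma inner_adjointl x y : inner (adjoint A x) y = inner x (A y).
Proof. by rewrite inner_conj -adjointP -inner_conj. Qed.

(** From |A^* x|^2 = <A A^* x, x>; it transfers bounds, strict ones included,
    from A to its adjoint. *)
Lemma sqr_rnorm_adjoint x :
  rnorm (adjoint A x) ^+ 2 <= rnorm (A (adjoint A x)) * rnorm x.
Proof.
apply: le_trans (CauchySchwarz _ _); rewrite adjointP inner_sqr.
by rewrite rnormR ?sqr_ge0.
Qed.

Lemma rnorm_adjoint_le x : rnorm (adjoint A x) <= opnorm A * rnorm x.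
Proof.
have [->|Ax] := eqVneq (adjoint A x) 0.
  by rewrite rnorm0 mulr_ge0 ?rnorm_ge0 ?opnorm_ge0.
rewrite -(@ler_pM2l _ (rnorm (adjoint A x))) ?rnorm_gt0// -expr2.
apply: (le_trans (sqr_rnorm_adjoint x)); rewrite mulrA ler_wpM2r ?rnorm_ge0//.
by rewrite mulrC rnorm_le_opnorm.
Qed.

Lemma not_attains_adjoint_lt x : 0 < opnorm A -> ~ attains_norm A -> x != 0 ->
  rnorm (adjoint A x) < opnorm A * rnorm x.
Proof.
move=> d0 nA x0; have [->|Ax] := eqVneq (adjoint A x) 0.
  by rewrite rnorm0 mulr_gt0// rnorm_gt0.
rewrite -(@ltr_pM2l _ (rnorm (adjoint A x))) ?rnorm_gt0// -expr2.
apply: (le_lt_trans (sqr_rnorm_adjoint x)); rewrite mulrA ltr_pM2r ?rnorm_gt0//.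
by rewrite mulrC not_attains_lt.
Qed.

(** The unit vector x = A y / |A y| for which T compressed to the span of (x, 0)
    and (0, y) is the matrix S_t with t = |A y|. *)
Lemma image_direction y : A y != 0 ->
  exists x, rnorm x = 1 /\ inner (A y) x = (rnorm (A y))%:C.
Proof.
move=> Ay; exists ((rnorm (A y))^-1%:C *: A y); have rA : rnorm (A y) != 0.
  by rewrite rnorm_eq0.
rewrite rnormZ rnormR ?invr_ge0 ?rnorm_ge0// mulVf//; split=> //.
rewrite linearZr_LR/= conjR inner_sqr -rmorphM/= expr2 mulKf//.
Qed.

End AdjointNorm.
End HilbertTheory.

(** * The numerical range of the block operator *)

Section BlockOperatorTheory.
Variables (R : realType) (H K : hilbertType R) (a b c : R[i]).
Variable A : boundedOp K H.
Local Notation T := (blockop a b c A : boundedOp (hsum H K) (hsum H K)).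

Lemma sqr_rnorm_hsum (u : hsum H K) :
  rnorm u ^+ 2 = rnorm u.1 ^+ 2 + rnorm u.2 ^+ 2.
Proof.
by apply: (@complexI R); rewrite rmorphD !rmorphXn/= -!rnormE; exact: hsum_normE.
Qed.

Lemma inner_blockop (u : hsum H K) : rnorm u = 1 ->
  inner (T u) u = form_value a b c (rnorm u.1 ^+ 2) (inner (A u.2) u.1).
Proof.
move=> u1; have := sqr_rnorm_hsum u; rewrite u1 expr1n => uu.
have -> : inner (T u) u = inner (T u).1 u.1 + inner (T u).2 u.2 by [].
rewrite /= !linearDl !linearZl_LR/= inner_adjointl (inner_conj (A u.2)).
have uC : inner u.2 u.2 = 1 - inner u.1 u.1.
  by rewrite !inner_sqr -[1](rmorph1 (real_complex R)) uu rmorphD addrC addKr.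
by rewrite uC /form_value -inner_sqr; ring.
Qed.

Lemma numrange_blockopE (w : R[i]) : numrange T w <->
  exists x y, rnorm x ^+ 2 + rnorm y ^+ 2 = 1 /\
    w = form_value a b c (rnorm x ^+ 2) (inner (A y) x).
Proof.
split=> [[u /norm_eq1 u1 <-]|[x [y [xy ->]]]].
  by exists u.1, u.2; rewrite -sqr_rnorm_hsum u1 expr1n -inner_blockop.
have u1 : rnorm ((x, y) : hsum H K) = 1.
  apply/eqP; rewrite -(@eqrXn2 _ 2) ?rnorm_ge0 ?ler01// expr1n.
  by rewrite sqr_rnorm_hsum/= xy.
by exists (x, y); [exact/norm_eq1|rewrite inner_blockop].
Qed.

(** Cauchy-Schwarz puts (|x|^2, <Ay, x>) in the solid ellipsoid of size t. *)
Lemma form_value_numrange_block2 (t : R) (x : H) (y : K) : 0 < t ->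
  rnorm x ^+ 2 + rnorm y ^+ 2 = 1 ->
  rnorm (A y) <= t * rnorm y ->
  mx_numrange (block2 a b c t%:C) (form_value a b c (rnorm x ^+ 2) (inner (A y) x)).
Proof.
move=> t0 xy Ay; apply: numrange_block2_solid => //.
rewrite -[X in X - _]xy (addrC (_ ^+ 2)) addrK -!exprMn.
rewrite ler_sqr ?nnegrE ?mulr_ge0 ?rnorm_ge0 ?(ltW t0)//.
apply: (le_trans (CauchySchwarz _ _)).
by rewrite mulrCA [leRHS]mulrC ler_wpM2r ?rnorm_ge0.
Qed.

(** A point r^2, t r s e of the ellipsoid is realised by r x and s e y, where
    x is the direction of A y. *)
Lemma numrange_block2_sub y : rnorm y = 1 -> A y != 0 ->
  mx_numrange (block2 a b c (rnorm (A y))%:C) `<=` numrange T.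
Proof.
move=> y1 Ay w; have t0 : 0 < rnorm (A y) by rewrite rnorm_gt0.
have [x [x1 Axy]] := image_direction Ay.
move=> /(mem_numrange_block2 _ _ _ _ t0)[p [z [zp ->]]].
have [r [s [e [[r0 s0 r2 s2] [e1 zE]]]]] := sphere_coordinates t0 zp.
apply/numrange_blockopE; exists (r%:C *: x), ((s%:C * e) *: y).
rewrite !rnormZ x1 y1 rnormM e1 !mulr1 !rnormR// r2 s2; split.
  by rewrite addrC subrK.
rewrite (linearZZ A)/= innerZZ Axy conjR zE !rmorphM/=; congr form_value; ring.
Qed.

Lemma numrange_blockop_attains : 0 < opnorm A -> attains_norm A ->
  numrange T = mx_numrange (block2 a b c (opnorm A)%:C).
Proof.
move=> d0 /attains_normE[y [y1 Ay]]; apply/seteqP; split.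
  move=> w /numrange_blockopE[x [y' [xy ->]]].
  by apply: form_value_numrange_block2 => //; exact: rnorm_le_opnorm.
by rewrite -Ay; apply: numrange_block2_sub => //; rewrite -rnorm_gt0 Ay.
Qed.

Lemma numrange_blockop_not_attains : 0 < opnorm A -> ~ attains_norm A ->
  numrange T =
  \bigcup_(t in [set t : R | 0 < t < opnorm A]) mx_numrange (block2 a b c t%:C).
Proof.
move=> d0 nA; apply/seteqP; split.
  move=> w /numrange_blockopE[x [y [xy ->]]].
  have [t [t0 td Ay]] : exists t,
      [/\ 0 < t, t < opnorm A & rnorm (A y) <= t * rnorm y].
    (* The ratio |Ay| / |y| may vanish; d / 2 serves to keep t positive. *)
    have d2 : 0 < opnorm A / 2 by rewrite divr_gt0.
    have d2d : opnorm A / 2 < opnorm A by rewrite ltr_pdivrMr// ltr_pMr// ltr1n.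
    have [->|y0] := eqVneq y 0.
      by exists (opnorm A / 2); split=> //; rewrite linear0 !rnorm0 mulr0.
    have y_gt0 : 0 < rnorm y by rewrite rnorm_gt0.
    exists (Num.max (opnorm A / 2) (rnorm (A y) / rnorm y)).
    rewrite lt_max d2 gt_max d2d ltr_pdivrMr// not_attains_lt//; split=> //.
    by rewrite -ler_pdivrMr// le_max lexx orbT.
  by exists t; [apply/andP|exact: form_value_numrange_block2].
move=> w [t /andP[t0 td]] tw.
have [|y [y1 ty]] := @opnorm_approx _ _ _ A t; first by rewrite (ltW t0).
apply: (numrange_block2_sub y1); first by rewrite -rnorm_gt0 (lt_trans t0).
exact: numrange_block2_mono (ltW ty) _ tw.
Qed.

(** * Norm attainment of the block operator *)

(** The largest value of |T(x, y)|^2 for |x| = r and |y| = s, when A is t times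
    a surjective isometry and the phases are optimal. *)
Definition normform (t r s : R) : R :=
  qform (rnorm a ^+ 2 + rnorm c ^+ 2 * t ^+ 2) (rnorm b ^+ 2 + t ^+ 2)
    (rnorm (a + c * (b^*)%R) * t) r s.

Lemma sqr_rnorm_blockop (u : hsum H K) : rnorm (T u) ^+ 2 =
  rnorm a ^+ 2 * rnorm u.1 ^+ 2 + rnorm (A u.2) ^+ 2
  + (rnorm c ^+ 2 * rnorm (adjoint A u.1) ^+ 2 + rnorm b ^+ 2 * rnorm u.2 ^+ 2)
  + 2 * complex.Re ((a + c * (b^*)%R) * inner u.1 (A u.2)).
Proof.
rewrite sqr_rnorm_hsum/= !sqr_rnormD !rnormZ !exprMn innerZZ linearZl_LR/=.
rewrite inner_adjointl (mulrDl a).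
by move: (a * _) (c * _ * _) => [? ?] [? ?] /=; ring.
Qed.

Lemma rnorm_blockop_le t (u : hsum H K) : 0 <= t ->
  rnorm (A u.2) <= t * rnorm u.2 -> rnorm (adjoint A u.1) <= t * rnorm u.1 ->
  rnorm (T u) ^+ 2 <= normform t (rnorm u.1) (rnorm u.2).
Proof.
move=> t0 Au Bu; rewrite sqr_rnorm_blockop /normform /qform.
have sq (x y : R) : 0 <= x -> x <= y -> x ^+ 2 <= y ^+ 2.
  by move=> x0 xy; rewrite ler_sqr ?nnegrE// (le_trans x0).
have := sq _ _ (rnorm_ge0 _) Au; have := sq _ _ (rnorm_ge0 _) Bu.
rewrite !exprMn => {}Bu Au2.
have : rnorm c ^+ 2 * rnorm (adjoint A u.1) ^+ 2 <=
    rnorm c ^+ 2 * (t ^+ 2 * rnorm u.1 ^+ 2) by rewrite ler_wpM2l// sqr_ge0.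
have : complex.Re ((a + c * (b^*)%R) * inner u.1 (A u.2)) <=
    rnorm (a + c * (b^*)%R) * (rnorm u.1 * (t * rnorm u.2)).
  apply: (le_trans (Re_le_rnorm _)); rewrite rnormM ler_wpM2l ?rnorm_ge0//.
  by apply: (le_trans (CauchySchwarz _ _)); rewrite ler_wpM2l ?rnorm_ge0.
lra.
Qed.

(** On the span of (x, 0) and (0, y), with x the direction of A y, the phase of
    the second component can be chosen to make the cross term of |T u|^2
    equal to its upper bound; A^* x has norm at least |A y|, by testing it
    against y. *)
Lemma rnorm_blockop_ge y r s : rnorm y = 1 -> A y != 0 -> 0 <= r -> 0 <= s ->
  exists u : hsum H K, rnorm u ^+ 2 = r ^+ 2 + s ^+ 2 /\
    normform (rnorm (A y)) r s <= rnorm (T u) ^+ 2.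
Proof.
move=> y1 Ay r0 s0; have [x [x1 Axy]] := image_direction Ay.
have [e [e1 mE]] := exists_phase (a + c * (b^*)%R).
exists (r%:C *: x, (s%:C * e) *: y); rewrite sqr_rnorm_hsum/=.
rewrite !rnormZ x1 y1 rnormM e1 !mulr1 !rnormR//; split=> //.
have Bx : rnorm (A y) <= rnorm (adjoint A x).
  have := CauchySchwarz y (adjoint A x).
  by rewrite -adjointP Axy rnormR ?rnorm_ge0// y1 mul1r.
have {}Bx : rnorm (A y) ^+ 2 <= rnorm (adjoint A x) ^+ 2.
  by rewrite ler_sqr ?nnegrE ?rnorm_ge0.
rewrite sqr_rnorm_blockop/= (linearZZ A) (linearZZ (adjoint A))/=.
rewrite !rnormZ rnormM e1 x1 y1 !rnormR// !mulr1.
rewrite !exprMn.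
have -> : (a + c * (b^*)%R) * inner (r%:C *: x) ((s%:C * e) *: A y) =
    (rnorm (a + c * (b^*)%R) * (r * s * rnorm (A y)))%:C.
  rewrite innerZZ inner_conj Axy !conjM !conjR {1}mE.
  rewrite [LHS](_ : _ = (rnorm (a + c * (b^*)%R))%:C * (e * (e^*)%R)
     * (r%:C * s%:C * (rnorm (A y))%:C)); last by ring.
  by rewrite mul_conjC e1 expr1n mulr1 -!rmorphM.
rewrite /normform /qform /=.
have : rnorm c ^+ 2 * (r ^+ 2 * rnorm (A y) ^+ 2) <=
    rnorm c ^+ 2 * (r ^+ 2 * rnorm (adjoint A x) ^+ 2).
  by rewrite !ler_wpM2l ?sqr_ge0.
lra.
Qed.

Lemma attains_blockop : 0 < opnorm A -> attains_norm A -> attains_norm T.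
Proof.
move=> d0 /attains_normE[y [y1 Ay]]; apply/attains_normP.
have g0 : 0 <= rnorm (a + c * (b^*)%R) * opnorm A.
  by rewrite mulr_ge0 ?rnorm_ge0 ?ltW.
have [la [r [s [[r0 s0 rs1] laE laM _]]]] :=
  qform_max (rnorm a ^+ 2 + rnorm c ^+ 2 * opnorm A ^+ 2)
    (rnorm b ^+ 2 + opnorm A ^+ 2) g0.
have [|u [u1]] := rnorm_blockop_ge y1 _ r0 s0; first by rewrite -rnorm_gt0 Ay.
rewrite Ay {}rs1 in u1 *; rewrite /normform {}laE => laT.
exists u; split.
  by apply/eqP; rewrite -(@eqrXn2 _ 2) ?rnorm_ge0 ?ler01// expr1n u1.
move=> v; rewrite -ler_sqr ?nnegrE ?mulr_ge0 ?rnorm_ge0// exprMn.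
apply: (@le_trans _ _ (la * rnorm v ^+ 2)); last by rewrite ler_wpM2r ?sqr_ge0.
rewrite (sqr_rnorm_hsum v); apply: le_trans (laM _ _).
apply: rnorm_blockop_le; rewrite ?opnorm_ge0 ?rnorm_le_opnorm//.
exact: rnorm_adjoint_le.
Qed.

(** Strict growth in t of the maximum on the circle.  The form itself grows
    strictly except at (1, 0) when c = 0, where both values are |a|^2; there the
    vector (|a|, t') shows that the maximum is at least |a|^2 + t'^2. *)
Lemma normform_lt t t' r s N : 0 <= t < t' -> 0 <= r -> 0 <= s ->
  r ^+ 2 + s ^+ 2 = 1 ->
  (forall r' s', 0 <= r' -> 0 <= s' ->
     normform t' r' s' <= N * (r' ^+ 2 + s' ^+ 2)) ->
  normform t r s < N.
Proof.
move=> /andP[t0 tt'] r0 s0 rs NT.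
have t'0 : 0 < t' by exact: le_lt_trans tt'.
have t2 : t ^+ 2 < t' ^+ 2 by rewrite ltr_sqr ?nnegrE// ltW.
have [s_eq0|sN] := eqVneq s 0; last first.
  have := NT r s r0 s0; rewrite rs mulr1 => /(lt_le_trans _); apply.
  apply: (@lt_le_trans _ _ (qform (rnorm a ^+ 2 + rnorm c ^+ 2 * t ^+ 2)
    (rnorm b ^+ 2 + t' ^+ 2) (rnorm (a + c * (b^*)%R) * t) r s)).
    by rewrite ltrD2r ltrD2l ltr_pM2r ?ltrD2l// exprn_gt0// lt_def sN.
  apply: ler_qform => //; last by rewrite ler_wpM2l ?rnorm_ge0 ?ltW.
  by rewrite lerD2l ler_wpM2l ?sqr_ge0 ?ltW.
have r2 : r ^+ 2 = 1 by rewrite -rs s_eq0 expr0n addr0.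
rewrite /normform /qform s_eq0 r2 expr0n/= !mulr0 !addr0 mulr1.
have [c0|cN] := eqVneq c 0; last first.
  have := NT 1 0 ler01 (lexx 0).
  rewrite /normform /qform expr0n expr1n !mulr0 !addr0 !mulr1.
  move=> /(lt_le_trans _); apply; rewrite ltrD2l.
  by rewrite ltr_pM2l// exprn_gt0// rnorm_gt0.
have := NT _ _ (rnorm_ge0 a) (ltW t'0).
rewrite /normform /qform c0 !mul0r rnorm0 expr0n !mul0r !addr0 => NT1.
have P0 : 0 < rnorm a ^+ 2 + t' ^+ 2 by rewrite ltr_wpDl ?sqr_ge0 ?exprn_gt0.
apply: (@lt_le_trans _ _ (rnorm a ^+ 2 + t' ^+ 2)); first by rewrite ltrDl exprn_gt0.
rewrite -(ler_pM2r P0); apply: le_trans NT1.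
have := mulr_ge0 (sqr_ge0 (rnorm b)) (sqr_ge0 t'); lra.
Qed.

Lemma attains_blockop_inv : 0 < opnorm A -> attains_norm T -> attains_norm A.
Proof.
move=> d0 /attains_normP[u [u1 uM]]; apply: contrapT => nA.
(* A single t < d bounds both A at u.2 and its adjoint at u.1. *)
have [t [t0 td Au Bu]] : exists t, [/\ 0 <= t, t < opnorm A,
    rnorm (A u.2) <= t * rnorm u.2 & rnorm (adjoint A u.1) <= t * rnorm u.1].
  have q (V W : normedModType R[i]) (f : boundedOp V W) (x : V) :
      (x != 0 -> rnorm (f x) < opnorm A * rnorm x) ->
      exists t, [/\ 0 <= t, t < opnorm A & rnorm (f x) <= t * rnorm x].
    have [-> _|x0 /(_ isT) fx] := eqVneq x 0.
      by exists 0; rewrite linear0 !rnorm0 mulr0.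
    have x_gt0 : 0 < rnorm x by rewrite rnorm_gt0.
    exists (rnorm (f x) / rnorm x).
    by rewrite divr_ge0 ?rnorm_ge0// ltr_pdivrMr// divfK ?gt_eqF.
  have [t1 [t10 t1d Au]] := q _ _ A u.2 (not_attains_lt nA).
  have [t2 [t20 t2d Bu]] := q _ _ (adjoint A) u.1 (not_attains_adjoint_lt d0 nA).
  exists (Num.max t1 t2); rewrite le_max t10 gt_max t1d t2d; split=> //.
    by apply: (le_trans Au); rewrite ler_wpM2r ?rnorm_ge0// le_max lexx.
  by apply: (le_trans Bu); rewrite ler_wpM2r ?rnorm_ge0// le_max lexx orbT.
have [|y [y1 ty]] := @opnorm_approx _ _ _ A t; first by rewrite t0.
have Ay : A y != 0 by rewrite -rnorm_gt0 (le_lt_trans t0).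
have : normform t (rnorm u.1) (rnorm u.2) < rnorm (T u) ^+ 2.
  apply: (@normform_lt _ (rnorm (A y))); rewrite ?rnorm_ge0 ?t0//.
    by rewrite -sqr_rnorm_hsum u1 expr1n.
  move=> r s r0 s0; have [v [<- vT]] := rnorm_blockop_ge y1 Ay r0 s0.
  by apply: (le_trans vT); rewrite -exprMn ler_sqr ?nnegrE ?mulr_ge0 ?rnorm_ge0.
by apply/negP; rewrite -leNgt rnorm_blockop_le.
Qed.

End BlockOperatorTheory.

Theorem theorem4p1 (R : realType) (H K : hilbertType R)
    (H_neq0 : exists x : H, x != 0) (K_neq0 : exists y : K, y != 0)
    (A : boundedOp K H) (A_neq0 : exists y : K, A y != 0) (a b c : R[i]) :
  let T : boundedOp (hsum H K) (hsum H K) := blockop a b c A in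
  let d : R := opnorm A in
  let S (t : R) : 'M[R[i]]_2 := block2 a b c t%:C in
  let E_d : set R[i] :=
    \bigcup_(t in [set t : R | 0 < t < d]) mx_numrange (S t) in
  (numrange T = mx_numrange (S d) \/ numrange T = E_d)
  /\ (numrange T = mx_numrange (S d) <-> attains_norm A)
  /\ (attains_norm A <-> attains_norm T).
Proof.
move=> T d S E_d.
have d0 : 0 < d.
  have [y Ay] := A_neq0; rewrite lt_def opnorm_ge0 andbT.
  apply: contra Ay => /eqP d0; rewrite -rnorm_eq0 eq_le rnorm_ge0 andbT.
  by rewrite (le_trans (rnorm_le_opnorm _ _))// -/d d0 mul0r.
have TS := @numrange_blockop_attains R H K a b c A d0.
have TE := @numrange_blockop_not_attains R H K a b c A d0.
split; first by have [/TS|/TE] := EM (attains_norm A); [left|right].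
split; last by split; [exact: attains_blockop|exact: attains_blockop_inv].
split=> // TSd; apply: contrapT => /TE TEd.
have [w [wd wE]] := numrange_block2_strict a b c d0.
by move: wd; rewrite -/(S d) -TSd TEd => -[t /wE].
Qed.
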